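(* Let $n\ge1$ be an integer and let $\mathcal P_{n-1}$ be the space of complex polynomials of degree at most $n-1$. Let $R$ be the operator $f(x)\mapsto f(-x)$ on $\mathcal P_{n-1}$ and $\tilde J_n$ the operator $x^p\mapsto x^{n-1-p}$ ($p=0,\dots,n-1$) on $\mathcal P_{n-1}$. Then $$\tilde U_n\,R\,\tilde U_n^{-1}=(-1)^{n-1}\tilde J_n .$$
   Context: The Euler polynomials $A_k(x)$ are defined by $\frac{A_k(x)}{(1-x)^{k+1}}=\sum_{m\ge0}m^kx^m$, and $\tilde A_k(x)=A_k(x)/x$ for $k\ge1$. $\tilde U_n$ is the linear operator on $\mathcal P_{n-1}$ with $\tilde U_n x^p=\frac{1}{n!}(1-x)^{n-1-p}\tilde A_{p+1}(x)$, $p=0,\dots,n-1$; it is invertible, with $\tilde U_n^{-1}x^p=(x-1)_p[x+1]_{n-p-1}$, where $(\varphi)_k=\varphi(\varphi-1)\cdots(\varphi-k+1)$ and $[\varphi]_k=\varphi(\varphi+1)\cdots(\varphi+k-1)$, both equal to $1$ for $k=0$. *)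

(* Defs.v *)
From HB Require Import structures.
From mathcomp Require Import all_boot all_order all_algebra.
From mathcomp Require Import ring zify.
From mathcomp Require Export reals complex.

Set Implicit Arguments.
Unset Strict Implicit.
Unset Printing Implicit Defensive.

Import Order.TTheory GRing.Theory Num.Theory.
Local Open Scope ring_scope.

(* Coefficient i of the product of the polynomial P with the formal power     *)
(* series \sum_m f m x^m.                                                     *)
Definition mul_fps (F : nzRingType) (P : {poly F}) (f : nat -> F) (i : nat) : F :=
  \sum_(j < i.+1) P`_j * f (i - j)%N.

(* A(x) / (1 - x)^(k+1) = \sum_(m >= 0) m^k x^m as formal power series,       *)
(* stated after multiplication by the unit (1 - x)^(k+1); 0 ^ 0 = 1.          *)
Definition is_euler_poly (F : nzRingType) (k : nat) (A : {poly F}) : Prop :=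
  forall i, A`_i = mul_fps ((1 - 'X) ^+ k.+1) (fun m => (m ^ k)%:R) i.

Lemma mul_fpsE (F : nzRingType) (P : {poly F}) (f : nat -> F) (N i : nat) :
  (i < N)%N -> mul_fps P f i = (P * \poly_(m < N) f m)`_i.
Proof.
move=> ltiN; rewrite coefM; apply: eq_bigr => j _.
by rewrite coef_poly (leq_ltn_trans (leq_subr _ _) ltiN).
Qed.

Lemma is_euler_poly_uniq (F : nzRingType) (k : nat) (A B : {poly F}) :
  is_euler_poly k A -> is_euler_poly k B -> A = B.
Proof. by move=> hA hB; apply/polyP => i; rewrite hA hB. Qed.

Lemma coef_mul_congr (F : comNzRingType) (P A B : {poly F}) (i : nat) :
  (forall j, (j <= i)%N -> A`_j = B`_j) -> (P * A)`_i = (P * B)`_i.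
Proof.
by move=> h; rewrite !coefM; apply: eq_bigr => j _; rewrite h ?leq_subr.
Qed.

Fixpoint euler_rec (F : comNzRingType) (k : nat) : {poly F} :=
  if k is k'.+1 then
    'X * (1 - 'X) * (euler_rec F k')^`() + (k'.+1%:R : {poly F}) * ('X * euler_rec F k')
  else 1.

Lemma euler_recP (F : comNzRingType) (k : nat) : is_euler_poly k (euler_rec F k).
Proof.
elim: k => [|k IH] i.
  rewrite /= (@mul_fpsE _ _ _ i.+1) // expr1 mulrBl mul1r coefB coefXM !coef_poly.
  rewrite coef1 leqnn expn0; case: i => [|i] /=; first by rewrite subr0.
  by rewrite leqW // expn0 subrr.
set f := fun m => (m ^ k)%:R : F.
pose T := \poly_(m < i.+2) f m.
pose Q := (1 - 'X : {poly F}) ^+ k.+1 * T.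
have AQ j : (j <= i.+1)%N -> (euler_rec F k)`_j = Q`_j.
  by move=> lej; rewrite IH (@mul_fpsE _ _ _ i.+2).
transitivity (('X * (1 - 'X) * Q^`() + (k.+1%:R : {poly F}) * ('X * Q))`_i).
  rewrite /= !coefD -!mulrA; congr (_ + _).
    rewrite mulrA [in RHS]mulrA.
    by apply: coef_mul_congr => l lel; rewrite !coef_deriv AQ.
  rewrite mulrA [in RHS]mulrA.
  by apply: coef_mul_congr => l lel; rewrite AQ // leqW.
have -> : 'X * (1 - 'X) * Q^`() + (k.+1%:R : {poly F}) * ('X * Q)
    = (1 - 'X) ^+ k.+2 * ('X * T^`()).
  rewrite /Q derivM deriv_exp derivB derivX derivC sub0r /= -mulr_natr !exprS.
  by ring.
rewrite (@mul_fpsE _ _ _ i.+1) //; apply: coef_mul_congr => j lej.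
rewrite coefXM [in RHS]coef_poly ltnS lej; case: j lej => [|j] lej /=.
  by rewrite exp0n.
rewrite coef_deriv coef_poly ltnS leqW // /f -[LHS]mulr_natr -natrM.
by rewrite expnSr.
Qed.

Lemma euler_poly_exists (F : comNzRingType) (k : nat) :
  {A : {poly F} | is_euler_poly k A}.
Proof. by exists (euler_rec F k); exact: euler_recP. Qed.

Definition euler_poly (F : comNzRingType) (k : nat) : {poly F} :=
  sval (euler_poly_exists F k).

Lemma euler_polyP (F : comNzRingType) (k : nat) : is_euler_poly k (euler_poly F k).
Proof. exact: svalP. Qed.

Lemma euler_poly_recE (F : comNzRingType) (k : nat) : euler_poly F k = euler_rec F k.
Proof. exact: is_euler_poly_uniq (@euler_polyP F k) (@euler_recP F k). Qed.

Lemma size_euler_poly (F : comNzRingType) (k : nat) :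
  (size (euler_poly F k) <= k.+1)%N.
Proof.
rewrite euler_poly_recE; elim: k => [|k IH] /=; first by rewrite size_poly1.
have hX : (size ('X * euler_rec F k : {poly F})%R <= k.+2)%N.
  by rewrite -commr_polyX; apply: leq_trans (size_polyMleq _ _) _; rewrite size_polyX addn2.
apply: leq_trans (size_polyD _ _) _; rewrite geq_max; apply/andP; split.
  have h1 : (size (1 - 'X : {poly F})%R <= 2)%N.
    by rewrite -opprB size_polyN -polyC1 size_XsubC.
  have hd : (size ((euler_rec F k)^`())%R <= k)%N.
    have [->|nz] := eqVneq (euler_rec F k) 0; first by rewrite linear0 size_poly0.
    by rewrite -ltnS; apply: leq_trans (lt_size_deriv nz) IH.
  rewrite -mulrA mulrC.
  apply: leq_trans (size_polyMleq _ _) _; rewrite size_polyX addn2 /= ltnS.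
  apply: leq_trans (size_polyMleq _ _) _.
  by rewrite -subn1 leq_subLR add1n; apply: leq_trans (leq_add h1 hd) _.
by rewrite mulr_natl -scaler_nat; apply: leq_trans (size_scale_leq _ _) hX.
Qed.

Definition euler_tilde (F : fieldType) (k : nat) : {poly F} := euler_poly F k %/ 'X.

Lemma euler_tildeE (F : fieldType) (k : nat) :
  (0 < k)%N -> euler_tilde F k * 'X = euler_poly F k.
Proof.
move=> k0; apply: divpK; rewrite -['X]subr0 -polyC0 dvdp_XsubCl.
apply/rootP; rewrite horner_coef0 euler_polyP /mul_fps big_ord1 subn0 exp0n //.
by rewrite mulr0.
Qed.

Lemma size_euler_tilde (F : fieldType) (k : nat) :
  (0 < k)%N -> (size (euler_tilde F k) <= k)%N.
Proof.
move=> k0; rewrite size_divp ?polyX_eq0 // size_polyX /= leq_subLR add1n.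
exact: size_euler_poly.
Qed.

(* The space of polynomials of degree at most n - 1 is {poly_n F}; below, e p *)
(* has size at most n for every p < n, so that npolyp is only a cast.         *)
Definition npoly_sum (F : fieldType) (n : nat) (e : nat -> {poly F})
    (f : {poly_n F}) : {poly_n F} :=
  \sum_(p < n) f`_p *: npolyp n (e p).

Lemma npoly_sum_is_linear (F : fieldType) (n : nat) (e : nat -> {poly F}) :
  linear (@npoly_sum F n e).
Proof.
move=> a f g; rewrite /npoly_sum scaler_sumr -big_split /=; apply: eq_bigr => p _.
by rewrite coefD coefZ scalerDl scalerA.
Qed.

HB.instance Definition _ (F : fieldType) (n : nat) (e : nat -> {poly F}) :=
  GRing.isLinear.Build F {poly_n F} {poly_n F} *:%R (@npoly_sum F n e)
    (@npoly_sum_is_linear F n e).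

Definition monomial_map (F : fieldType) (n : nat) (e : nat -> {poly F}) :
  'End({poly_n F}) := linfun (@npoly_sum F n e).

Lemma monomial_mapE (F : fieldType) (n : nat) (e : nat -> {poly F}) (p : 'I_n) :
  (size (e p) <= n)%N ->
  monomial_map n e (tnth (npolyX F n) p) = e p :> {poly F}.
Proof.
move=> he; rewrite lfunE /= /npoly_sum (bigD1 p) //= big1 => [|q neq].
  by rewrite addr0 npolyXE coefXn eqxx scale1r npolypK.
by rewrite npolyXE coefXn -val_eqE /= in neq *; rewrite (negPf neq) scale0r.
Qed.

Definition Utilde (F : fieldType) (n : nat) : 'End({poly_n F}) :=
  monomial_map n
    (fun p => (n`!%:R)^-1 *: ((1 - 'X) ^+ (n - 1 - p) * euler_tilde F p.+1)).

Definition Jtilde (F : fieldType) (n : nat) : 'End({poly_n F}) :=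
  monomial_map n (fun p => 'X^(n - 1 - p)).

Definition npoly_reflect (F : fieldType) (n : nat) (f : {poly_n F}) : {poly_n F} :=
  npolyp n (f \Po (- 'X)).

Lemma npoly_reflectE (F : fieldType) (n : nat) (f : {poly_n F}) :
  npoly_reflect f = f \Po (- 'X) :> {poly F}.
Proof.
rewrite /npoly_reflect npolypK // size_comp_poly2 ?size_npoly //.
by rewrite size_polyN size_polyX.
Qed.

Lemma npoly_reflect_is_linear (F : fieldType) (n : nat) :
  linear (@npoly_reflect F n).
Proof.
move=> a f g; apply: val_inj => /=.
by rewrite !npoly_reflectE /= linearP.
Qed.

HB.instance Definition _ (F : fieldType) (n : nat) :=
  GRing.isLinear.Build F {poly_n F} {poly_n F} *:%R (@npoly_reflect F n)
    (@npoly_reflect_is_linear F n).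

Definition Rop (F : fieldType) (n : nat) : 'End({poly_n F}) :=
  linfun (@npoly_reflect F n).

Lemma RopE (F : fieldType) (n : nat) (f : {poly_n F}) :
  Rop F n f = f \Po (- 'X) :> {poly F}.
Proof. by rewrite lfunE /= npoly_reflectE. Qed.

Lemma JtildeE (F : fieldType) (n : nat) (p : 'I_n) :
  Jtilde F n (tnth (npolyX F n) p) = 'X^(n - 1 - p) :> {poly F}.
Proof.
by rewrite monomial_mapE // size_polyXn; have := ltn_ord p; lia.
Qed.

Lemma size_Utilde_image (F : fieldType) (n p : nat) : (p < n)%N ->
  (size ((n`!%:R : F)^-1 *:
     ((1 - 'X) ^+ (n - 1 - p) * euler_tilde F p.+1) : {poly F})%R <= n)%N.
Proof.
move=> ltpn; apply: leq_trans (size_scale_leq _ _) _.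
apply: leq_trans (size_polyMleq _ _) _.
have h1 : (size ((1 - 'X : {poly F}) ^+ (n - 1 - p))%R <= (n - 1 - p).+1)%N.
  apply: leq_trans (size_poly_exp_leq _ _) _.
  by rewrite -opprB size_polyN -polyC1 size_XsubC mul1n.
rewrite -subn1 leq_subLR; apply: leq_trans (leq_add h1 (size_euler_tilde F _)) _ => //.
lia.
Qed.

Lemma UtildeE (F : fieldType) (n : nat) (p : 'I_n) :
  Utilde F n (tnth (npolyX F n) p) =
    (n`!%:R)^-1 *: ((1 - 'X) ^+ (n - 1 - p) * euler_tilde F p.+1) :> {poly F}.
Proof. by rewrite monomial_mapE // size_Utilde_image. Qed.

Lemma fps_mul_eq0 (F : comNzRingType) (u G : {poly F}) (N : nat) :
  u`_0 = 1 -> (forall i, (i < N)%N -> (u * G)`_i = 0) ->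
  forall i, (i < N)%N -> G`_i = 0.
Proof.
move=> u0 h i; elim/ltn_ind: i => i IH ltiN.
have := h i ltiN; rewrite coefM big_ord_recl /= u0 mul1r subn0 big1 ?addr0 // => j _.
rewrite IH ?mulr0 // /bump /=.
  by rewrite ltn_subrL add1n /= (leq_ltn_trans _ (ltn_ord j)).
by apply: leq_ltn_trans (leq_subr _ _) ltiN.
Qed.

(* Utilde is injective on a space of finite dimension, so the partial inverse *)
(* (Utilde F n)^-1 of vector.v is here a two-sided inverse.                   *)
Lemma lker_Utilde (F : numFieldType) (n : nat) : lker (Utilde F n) == 0%VS.
Proof.
apply/lker0P => f g hfg; apply: subr0_eq.
have : Utilde F n (f - g) = 0 by rewrite linearB /= hfg subrr.
move: (f - g) => {f g hfg} h; rewrite lfunE /= => hU.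
have {}hU : \sum_(p < n) h`_p *: ((1 - 'X) ^+ (n - 1 - p) * euler_poly F p.+1) = 0.
  have /(congr1 (fun q : {poly_n F} => n`!%:R *: ((q : {poly F}) * 'X))) := hU.
  rewrite /= mul0r scaler0 => hU'; rewrite -[RHS]hU'.
  rewrite /npoly_sum raddf_sum /= mulr_suml scaler_sumr; apply: eq_bigr => p _.
  rewrite npolypK ?size_Utilde_image // -!scalerAl !scalerA.
  rewrite -mulrA euler_tildeE //; congr (_ *: _).
  by rewrite mulrCA divff ?mulr1 // pnatr_eq0 -lt0n fact_gt0.
have hm (m : nat) : \sum_(p < n) h`_p * (m ^ p.+1)%:R = 0 :> F.
  pose G := \poly_(i < m.+1) (\sum_(p < n) h`_p * (i ^ p.+1)%:R : F).
  suff : G`_m = 0 by rewrite coef_poly ltnSn.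
  apply: (@fps_mul_eq0 _ ((1 - 'X) ^+ n.+1) G m.+1) => // [|i lti].
    by rewrite -horner_coef0 !hornerE subr0 expr1n.
  transitivity ((\sum_(p < n) h`_p *: ((1 - 'X) ^+ (n - 1 - p) * euler_poly F p.+1))`_i).
    rewrite coef_sum; have -> : G = \sum_(p < n) h`_p *: \poly_(i < m.+1) (i ^ p.+1)%:R.
      apply/polyP => j; rewrite coef_sum coef_poly; case: ifP => lej.
        by apply: eq_bigr => p _; rewrite coefZ coef_poly lej.
      by rewrite big1 // => p _; rewrite coefZ coef_poly lej mulr0.
    rewrite mulr_sumr coef_sum; apply: eq_bigr => p _.
    rewrite -scalerAr !coefZ; congr (_ * _).
    have -> : n.+1 = ((n - 1 - p) + p.+2)%N.
      by have := ltn_ord p; lia.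
    rewrite exprD -mulrA; apply: coef_mul_congr => j lej.
    by rewrite euler_polyP (@mul_fpsE _ _ _ m.+1) // (leq_ltn_trans lej).
  by rewrite hU coef0.
apply: val_inj => /=; apply/eqP/contraT => hn0.
pose rs := [seq (m.+1)%:R : F | m <- iota 0 n].
suff /(max_poly_roots hn0) : all (root (h : {poly F})) rs.
  rewrite size_map size_iota ltnNge size_npoly; apply.
  by rewrite map_inj_uniq ?iota_uniq // => a b /eqP; rewrite eqr_nat => /eqP[].
apply/allP => _ /mapP[m _ ->]; apply/rootP.
rewrite (horner_coef_wide _ (size_npoly h)).
apply: (@mulIf _ (m.+1%:R)); first by rewrite pnatr_eq0.
rewrite mul0r -[RHS](hm m.+1) mulr_suml; apply: eq_bigr => p _.
by rewrite -mulrA -exprSr natrX.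
Qed.

(* Main.v *)
Require Import Defs.
From mathcomp Require Import all_boot all_order all_algebra.
From mathcomp Require Import reals complex.
From mathcomp Require Import ring zify.
Import GRing.Theory.
Local Open Scope ring_scope.

(** The polynomials A_(p+1)(x)/x are palindromic of degree p, because the
    recurrence on the Eulerian numbers is symmetric, and 1 - x is
    antipalindromic of degree 1.  Hence reversing the coefficients of
    U x^p, which is a multiple of (1 - x)^(n-1-p) A_(p+1)(x)/x, multiplies it by
    (-1)^(n-1-p).  As R multiplies x^p by (-1)^p, this is
    U R = (-1)^(n-1) J U on each monomial, and U is invertible. *)

(* [x^d P(1/x) = c P(x)], with [P] of degree at most [d]. *)
Definition self_reciprocal (F : nzRingType) (d : nat) (c : F) (P : {poly F}) :=
  (size P <= d.+1)%N /\ forall i j, (i + j = d)%N -> P`_i = c * P`_j.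

Lemma self_reciprocal_mul_1subX (F : comNzRingType) (d : nat) (c : F)
    (P : {poly F}) :
  self_reciprocal F d c P -> self_reciprocal F d.+1 (- c) ((1 - 'X) * P).
Proof.
(* At the two end indices [0] and [d.+1] of the product, the coefficient of [P] just above degree
   [d] enters. *)
case=> szP symP; have P0 : P`_d.+1 = 0 by rewrite nth_default.
split=> [|i j eij].
  apply: leq_trans (size_polyMleq _ _) _.
  by rewrite -opprB size_polyN size_XsubC /= add1n ltnS.
rewrite mulrBl mul1r !coefB !coefXM.
case: i j eij => [|i] [|j] //= eij.
- have -> : j = d by lia.
  by rewrite P0 (symP 0 d)%N //; ring.
- have -> : i = d by lia.
  by rewrite P0 (symP d 0)%N ?addn0 //; ring.
by rewrite (symP i.+1 j) ?(symP i j.+1); [ring | lia | lia].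
Qed.

Lemma self_reciprocal_mul_1subX_exp (F : comNzRingType) (m d : nat) (c : F)
    (P : {poly F}) :
  self_reciprocal F d c P ->
  self_reciprocal F (m + d) ((-1) ^+ m * c) ((1 - 'X) ^+ m * P).
Proof.
move=> hP; elim: m => [|m IH]; first by rewrite !expr0 !mul1r.
by rewrite !exprS -!mulrA mulN1r; apply: self_reciprocal_mul_1subX.
Qed.

(** The Eulerian-number recurrence, read off the differential recurrence [euler_rec]. The weight of
    the last term is a difference in [F], so nothing is truncated for large [i]. *)
Lemma coef_euler_polyS (F : comNzRingType) (k i : nat) :
  (euler_poly F k.+1)`_i.+1 =
    i.+1%:R * (euler_poly F k)`_i.+1 + (k.+1%:R - i%:R) * (euler_poly F k)`_i.
Proof.
rewrite !euler_poly_recE /= coefD -mulrA coefXM /= mulrBl mul1r coefB coefXM.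
rewrite -polyC_natr coefCM coefXM /= !coef_deriv.
case: i => [|i] /=; first by ring.
by ring.
Qed.

(** The centre of symmetry reflects that the coefficients live in degrees [1] to [k.+1]: [A0] and
    [AS] settle the ends, and the recurrence carries the symmetry inwards by induction. *)
Lemma euler_poly_sym (F : comNzRingType) (k i j : nat) :
  (i + j = k.+2)%N -> (euler_poly F k.+1)`_i = (euler_poly F k.+1)`_j.
Proof.
have A0 l : (euler_poly F l.+1)`_0 = 0.
  by rewrite euler_polyP /mul_fps big_ord1 exp0n // mulr0.
have AS l : (euler_poly F l)`_l.+1 = 0.
  by apply: nth_default; exact: size_euler_poly.
elim: k i j => [|k IH] [|i] [|j] // eij.
- have -> : j = 1%N by lia.
  by rewrite A0 AS.
- have -> : i = 1%N by lia.
  by rewrite A0 AS.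
- by have [-> ->] : i = 0%N /\ j = 0%N by lia.
- have -> : j = k.+2 by lia.
  by rewrite A0 AS.
- have -> : i = k.+2 by lia.
  by rewrite A0 AS.
rewrite !(coef_euler_polyS F k.+1) (IH i.+1 j); last by lia.
rewrite (IH i j.+1); last by lia.
(* The weights [k.+2 - i] and [k.+2 - j] become [j + 1] and [i + 1], so both sides have the same two
   terms, swapped. *)
have -> : k.+2%:R = i%:R + j%:R + 1 :> F by rewrite -natrD natr1; congr _%:R; lia.
ring.
Qed.

(** Dividing by ['X] lowers both indices by one, turning the index sum [k.+2] into [k]. *)
Lemma self_reciprocal_euler_tilde (F : fieldType) (k : nat) :
  self_reciprocal F k 1 (euler_tilde F k.+1).
Proof.
split=> [|i j eij]; first exact: size_euler_tilde.
have coefE l : (euler_tilde F k.+1)`_l = (euler_poly F k.+1)`_l.+1.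
  by rewrite -euler_tildeE // coefMX.
by rewrite !coefE mul1r; apply: euler_poly_sym; lia.
Qed.

Lemma coef_Jtilde (F : fieldType) (n : nat) (f : {poly_n F}) (i : nat) :
  (i < n)%N -> (Jtilde F n f)`_i = f`_(n - 1 - i).
Proof.
move=> ltin; have ltr : (n - 1 - i < n)%N by lia.
(* Only the monomial of exponent [n - 1 - i] is sent to ['X^i]. *)
rewrite lfunE /= /npoly_sum raddf_sum /= coef_sum (bigD1 (Ordinal ltr)) //=.
have szX p : (p < n)%N -> (size ('X^(n - 1 - p) : {poly F}) <= n)%N.
  by move=> ltp; rewrite size_polyXn; lia.
rewrite npolypK ?szX // coefZ coefXn.
have -> : (n - 1 - (n - 1 - i) = i)%N by lia.
rewrite eqxx mulr1 big1 ?addr0 // => p nep.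
rewrite npolypK ?szX // coefZ coefXn; case: eqP => [ei|]; last by rewrite mulr0.
by case/eqP: nep; apply: val_inj => /=; have := ltn_ord p; lia.
Qed.

Lemma coef_Utilde (F : fieldType) (n : nat) (f : {poly_n F}) (i : nat) :
  (Utilde F n f)`_i = \sum_(p < n) f`_p * (n`!%:R^-1 *
    ((1 - 'X) ^+ (n - 1 - p) * euler_tilde F p.+1)`_i).
Proof.
rewrite lfunE /= /npoly_sum raddf_sum /= coef_sum; apply: eq_bigr => p _.
by rewrite npolypK ?size_Utilde_image // !coefZ.
Qed.

Lemma coef_Rop (F : fieldType) (n : nat) (f : {poly_n F}) (i : nat) :
  (Rop F n f)`_i = (-1) ^+ i * f`_i.
Proof.
have -> : Rop F n f = \poly_(j < size f) ((-1) ^+ j * f`_j) :> {poly F}.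
  rewrite RopE comp_polyE poly_def; apply: eq_bigr => j _.
  by rewrite -scaleN1r exprZn scalerA mulrC.
by rewrite coef_poly; case: ltnP => // lefi; rewrite nth_default ?mulr0.
Qed.

Lemma Utilde_comp_Rop (F : fieldType) (n : nat) :
  (Utilde F n \o Rop F n)%VF = (-1) ^+ (n - 1) *: (Jtilde F n \o Utilde F n)%VF.
Proof.
apply/lfunP => f; rewrite scale_lfunE !comp_lfunE; apply/val_inj/polyP => i /=.
rewrite coefZ; have [lein|ltin] := leqP n i.
  by rewrite !nth_default ?mulr0 // (leq_trans (size_npoly _)).
rewrite coef_Jtilde // !coef_Utilde mulr_sumr; apply: eq_bigr => p _.
rewrite coef_Rop.
have [_ sym] := self_reciprocal_mul_1subX_exp _ (n - 1 - p) _ _ _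
  (self_reciprocal_euler_tilde F p).
have ltpn := ltn_ord p.
(* The reciprocity degree [(n - 1 - p) + p] equals [n - 1] for every [p], which is why one reversal
   serves all terms. *)
rewrite (sym (n - 1 - i)%N i); last by lia.
have -> : (-1) ^+ (n - 1) = (-1) ^+ p * (-1) ^+ (n - 1 - p) :> F.
  by rewrite -exprD; congr (_ ^+ _); lia.
have sq : (-1) ^+ (n - 1 - p) * (-1) ^+ (n - 1 - p) = 1 :> F.
  by rewrite -expr2 sqrr_sign.
move: ((-1) ^+ (n - 1 - p)) sq => s sq; rewrite mulr1.
(* The right side carries the sign [s] twice, from [(-1) ^+ (n - 1)] and from [sym]; inserting
   [s * s] on the left matches it. *)
rewrite -[LHS]mulr1 -sq; ring.
Qed.

Theorem theorem1 (R : realType) (n : nat) (hn : (1 <= n)%N) :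
  (Utilde R[i] n \o Rop R[i] n \o (Utilde R[i] n)^-1)%VF
  = (-1) ^+ (n - 1) *: Jtilde R[i] n.
Proof.
rewrite Utilde_comp_Rop -comp_lfunZl -comp_lfunA.
by rewrite lker0_compfV ?lker_Utilde // comp_lfun1r.
Qed.
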